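(* Let $\Phi\in\{\Gamma_k,\mathcal{K}\}$, $\Psi\in\{\Gamma,\Omega\}$ and $\star\in\{1,fin\}$. Then for a space $X$ the following statements are equivalent: (1) $X$ satisfies $S_\star(\Phi,\Psi)$; (2) the bitopological space $(2^X,\mathbf{F}^+,\mathbf{Z}^+)$ satisfies $S_\star(\mathcal{D}^{\mathbf{F}^+}_\Phi,\mathcal{D}^{\mathbf{Z}^+}_\Psi)$.
   Context: Standing assumption: all spaces are Hausdorff and non-compact unless otherwise stated. For a space $X$, $2^X$ is the family of all closed subsets of $X$ (including $\emptyset$). For $A\subseteq X$ put $A^c=X\setminus A$ and $A^+=\{F\in 2^X: F\subseteq A\}$. The upper Fell topology $\mathbf{F}^+$ on $2^X$ has base $\{(D^c)^+: D\subseteq X \text{ non-empty compact}\}\cup\{2^X\}$; the $\mathbf{Z}^+$-topology has base $\{(D^c)^+: D\subseteq X \text{ non-empty finite}\}\cup\{2^X\}$. Covers are non-trivial: $\mathcal{U}$ is a cover of $X$ if $X=\bigcup\mathcal{U}$ and $X\notin\mathcal{U}$. An open cover $\mathcal{U}$ of $X$ is an $\omega$-cover (a $k$-cover) if each finite (compact) subset of $X$ is contained in an element of $\mathcal{U}$; it is a $\gamma$-cover (a $\gamma_k$-cover) if it is infinite and for each finite (compact) $C\subseteq X$ the set $\{U\in\mathcal{U}: C\not\subseteq U\}$ is finite. $\Omega,\mathcal{K},\Gamma,\Gamma_k$ are the families of all open $\omega$-covers, $k$-covers, $\gamma$-covers, $\gamma_k$-covers of $X$, respectively. Selection principles: $S_1(\mathcal{A},\mathcal{B})$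 says that for each sequence $(A_n)_{n\in\mathbb{N}}$ of elements of $\mathcal{A}$ there are $b_n\in A_n$ ($n\in\mathbb{N}$) such that $\{b_n:n\in\mathbb{N}\}\in\mathcal{B}$. $S_{fin}(\mathcal{A},\mathcal{B})$ says that for each sequence $(A_n)_{n\in\mathbb{N}}$ of elements of $\mathcal{A}$ there are finite sets $B_n\subseteq A_n$ such that $\bigcup_{n\in\mathbb{N}}B_n\in\mathcal{B}$. For a topology $\tau\in\{\mathbf{F}^+,\mathbf{Z}^+\}$ on $2^X$: $\mathcal{D}^\tau_\Omega$ is the family of all dense subsets $\mathcal{A}$ of $(2^X,\tau)$ with $\emptyset\notin\mathcal{A}$; $\mathcal{D}^\tau_\Gamma$ is the family of all infinite $\mathcal{A}\subseteq 2^X$ with $\emptyset\notin\mathcal{A}$ that converge to $\{\emptyset\}$, meaning that for every $F\in 2^X$ and every $\tau$-neighborhood $W$ of $F$ the set $\{A\in\mathcal{A}: A\notin W\}$ is finite. Moreover $\mathcal{D}^{\mathbf{F}^+}_{\mathcal{K}}:=\mathcal{D}^{\mathbf{F}^+}_\Omega$ and $\mathcal{D}^{\mathbf{F}^+}_{\Gamma_k}:=\mathcal{D}^{\mathbf{F}^+}_\Gamma$. *)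

(* Defs.v *)
From HB Require Import structures.
From mathcomp Require Import all_boot all_order.
From mathcomp Require Import all_classical topology.

Set Implicit Arguments.
Unset Strict Implicit.
Unset Printing Implicit Defensive.

Local Open Scope classical_set_scope.

Section covers.
Context {X : topologicalType}.
Implicit Types U : set (set X).

Definition nontrivial_cover U := \bigcup_(V in U) V = [set: X] /\ ~ U [set: X].

Definition nontrivial_open_cover U := nontrivial_cover U /\ U `<=` open.

Definition omega_cover U := nontrivial_open_cover U /\
  forall C : set X, finite_set C -> exists2 V, U V & C `<=` V.

Definition k_cover U := nontrivial_open_cover U /\
  forall C : set X, compact C -> exists2 V, U V & C `<=` V.

Definition gamma_cover U := [/\ nontrivial_open_cover U, infinite_set U &
  forall C : set X, finite_set C -> finite_set [set V | U V /\ ~ C `<=` V]].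

Definition gamma_k_cover U := [/\ nontrivial_open_cover U, infinite_set U &
  forall C : set X, compact C -> finite_set [set V | U V /\ ~ C `<=` V]].

End covers.

Section selection_principles.
Context {T : Type}.
Implicit Types A B : set (set T).

Definition S_1 A B := forall a : nat -> set T, (forall n, A (a n)) ->
  exists b : nat -> T, (forall n, a n (b n)) /\ B (range b).

Definition S_fin A B := forall a : nat -> set T, (forall n, A (a n)) ->
  exists b : nat -> set T,
    (forall n, finite_set (b n) /\ b n `<=` a n) /\ B (\bigcup_n b n).

End selection_principles.

(* 2^X, the type of all closed subsets of X, the empty one included *)
Definition hyperspace (X : topologicalType) : Type := set_type (@closed X).

HB.instance Definition _ (X : topologicalType) := Choice.on (hyperspace X).

Section hyperspace_sets.
Context {X : topologicalType}.

Definition empty_closed : hyperspace X := SigSub (mem_set (@closed0 X)).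

(* A^+ *)
Definition plus_set (A : set X) : set (hyperspace X) :=
  [set F | val F `<=` A].

End hyperspace_sets.

Definition fell_base (X : topologicalType) : set (set (hyperspace X)) :=
  [set plus_set (~` D) | D in [set D : set X | D !=set0 /\ compact D]]
    `|` [set [set: hyperspace X]].

Definition z_base (X : topologicalType) : set (set (hyperspace X)) :=
  [set plus_set (~` D) | D in [set D : set X | D !=set0 /\ finite_set D]]
    `|` [set [set: hyperspace X]].

Lemma plus_setI (X : topologicalType) (A B : set X) :
  plus_set A `&` plus_set B = plus_set (A `&` B).
Proof. by apply/seteqP; split => F /=; rewrite /plus_set /= subsetI. Qed.

Lemma miss_base_cover (X : topologicalType) (P : set (set X)) :
  \bigcup_(W in [set plus_set (~` D) | D in P] `|` [set [set: hyperspace X]]) W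
    = [set: hyperspace X].
Proof. by apply/seteqP; split => // F _; exists [set: hyperspace X] => //; right. Qed.

Lemma miss_base_join (X : topologicalType) (P : set (set X)) :
  setU_closed P ->
  let B := [set plus_set (~` D) | D in P] `|` [set [set: hyperspace X]] in
  forall V W t, B V -> B W -> V t -> W t ->
    exists Z, [/\ B Z, Z t & Z `<=` V `&` W].
Proof.
move=> PU B V W t BV BW Vt Wt; exists (V `&` W); split=> //.
case: BV => [[D PD <-{V Vt}]|->]; last by rewrite setTI.
case: BW => [[E PE <-{W Wt}]|->]; last by rewrite setIT; left; exists D.
by left; exists (D `|` E); [exact: PU|rewrite setCU plus_setI].
Qed.

Lemma fell_base_join (X : topologicalType) V W (t : hyperspace X) :
  fell_base V -> fell_base W -> V t -> W t ->
  exists Z, [/\ fell_base Z, Z t & Z `<=` V `&` W].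
Proof.
apply: miss_base_join => D E [[x Dx] cD] [_ cE]; split; first by exists x; left.
exact: compactU.
Qed.

Lemma z_base_join (X : topologicalType) V W (t : hyperspace X) :
  z_base V -> z_base W -> V t -> W t ->
  exists Z, [/\ z_base Z, Z t & Z `<=` V `&` W].
Proof.
apply: miss_base_join => D E [[x Dx] fD] [_ fE]; split; first by exists x; left.
by rewrite finite_setU.
Qed.

(* Aliases of 2^X, carrying the upper Fell topology and the Z^+-topology. *)
Definition fell_plus (X : topologicalType) : Type := hyperspace X.
Definition z_plus (X : topologicalType) : Type := hyperspace X.

HB.instance Definition _ (X : topologicalType) := Choice.on (fell_plus X).
HB.instance Definition _ (X : topologicalType) :=
  @isBaseTopological.Build (fell_plus X) (set (hyperspace X)) (@fell_base X) id
    (miss_base_cover _) (@fell_base_join X).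

HB.instance Definition _ (X : topologicalType) := Choice.on (z_plus X).
HB.instance Definition _ (X : topologicalType) :=
  @isBaseTopological.Build (z_plus X) (set (hyperspace X)) (@z_base X) id
    (miss_base_cover _) (@z_base_join X).

Lemma fell_base_basis (X : topologicalType) :
  @basis (fell_plus X) (@fell_base X).
Proof.
split=> [V BV|F W [V [[D sD <-] [V' DV' V'F] sW]]].
  by exists [set V] => [_ ->//|]; rewrite bigcup_set1.
exists V'; first by split; [exact: sD|].
by move=> G V'G; apply: sW; exists V'.
Qed.

Lemma z_base_basis (X : topologicalType) : @basis (z_plus X) (@z_base X).
Proof.
split=> [V BV|F W [V [[D sD <-] [V' DV' V'F] sW]]].
  by exists [set V] => [_ ->//|]; rewrite bigcup_set1.
exists V'; first by split; [exact: sD|].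
by move=> G V'G; apply: sW; exists V'.
Qed.

(* [T] is one of the two topologies on 2^X and [e] the empty closed set. *)
Section hyperspace_families.
Context (T : topologicalType) (e : T).

Definition D_Omega : set (set T) := [set A | dense A /\ ~ A e].

Definition D_Gamma : set (set T) := [set A | [/\ infinite_set A, ~ A e &
  forall (F : T) (W : set T), nbhs F W -> finite_set [set G | A G /\ ~ W G]]].

End hyperspace_families.

Inductive star := star_1 | star_fin.
Inductive phi := phi_Gamma_k | phi_K.
Inductive psi := psi_Gamma | psi_Omega.

Definition S_star (s : star) (T : Type) (A B : set (set T)) : Prop :=
  match s with
  | star_1 => S_1 A B
  | star_fin => S_fin A B
  end.

Definition phi_covers (X : topologicalType) (p : phi) : set (set (set X)) :=
  match p with
  | phi_Gamma_k => gamma_k_cover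
  | phi_K => k_cover
  end.

Definition psi_covers (X : topologicalType) (q : psi) : set (set (set X)) :=
  match q with
  | psi_Gamma => gamma_cover
  | psi_Omega => omega_cover
  end.

Definition D_fell (X : topologicalType) (p : phi) : set (set (hyperspace X)) :=
  match p with
  | phi_Gamma_k => @D_Gamma (fell_plus X) empty_closed
  | phi_K => @D_Omega (fell_plus X) empty_closed
  end.

Definition D_z (X : topologicalType) (q : psi) : set (set (hyperspace X)) :=
  match q with
  | psi_Gamma => @D_Gamma (z_plus X) empty_closed
  | psi_Omega => @D_Omega (z_plus X) empty_closed
  end.

Arguments phi_covers : clear implicits.
Arguments psi_covers : clear implicits.
Arguments D_fell : clear implicits.
Arguments D_z : clear implicits.

(* Main.v *)
Require Import Defs.
From mathcomp Require Import all_boot all_order.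
From mathcomp Require Import all_classical topology.

(** The map sending a closed set to its complement is a bijection from [2^X]
    onto the open sets of [X]; a closed set [F] misses [D] iff [D] is contained
    in the complement of [F]. Under this bijection, dense sets become
    [k]-covers (or [omega]-covers), sets converging to the empty set become
    [gamma_k]-covers (or [gamma]-covers), and a selection principle is
    invariant under such a renaming of the elements. *)

Set Implicit Arguments.
Unset Strict Implicit.
Unset Printing Implicit Defensive.

Local Open Scope classical_set_scope.

Section selection_transfer.
Context {S T : Type} (f : S -> T).
Hypothesis f_inj : injective f.
Context (A B : set (set T)) (A' B' : set (set S)).
(** Complementation reaches only open sets, so [f] is in general not onto; confining the members of
    [A] to its range lets families be pulled back without loss. *)
Hypothesis A_range : forall U, A U -> U `<=` range f.
Hypothesis AE : forall W, A' W <-> A (f @` W).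
Hypothesis BE : forall W, B' W <-> B (f @` W).

Let A_preimage U : A U -> A' (f @^-1` U).
Proof.
move=> AU; apply/AE.
have -> // : f @` (f @^-1` U) = U.
apply/seteqP; split=> [_ [x Ux <-] //|y Uy].
by have [x _ xy] := A_range AU Uy; exists x => //=; rewrite xy.
Qed.

Lemma S_1_transfer : S_1 A B <-> S_1 A' B'.
Proof.
split=> SAB a Aa.
- have [b [ab Bb]] := SAB (fun n => f @` a n) (fun n => (AE _).1 (Aa n)).
  (* Each selected [b n] lies in the image of [a n]; choice picks preimages inside [a n]. *)
  have /choice[b' b'P] n : exists x, a n x /\ f x = b n.
    by have [x ax <-] := ab n; exists x.
  exists b'; split=> [n|]; first by have [] := b'P n.
  apply/BE; rewrite image_comp.
  by have -> : f \o b' = b by apply/funext => n; have [] := b'P n.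
- have [b [ab Bb]] := SAB (fun n => f @^-1` a n) (fun n => A_preimage (Aa n)).
  exists (f \o b); split=> [n|]; first exact: ab.
  by rewrite -(image_comp b f); apply/BE.
Qed.

Lemma S_fin_transfer : S_fin A B <-> S_fin A' B'.
Proof.
split=> SAB a Aa.
- have [b [ab Bb]] := SAB (fun n => f @` a n) (fun n => (AE _).1 (Aa n)).
  (* Injectivity keeps these preimages finite and inside [a n]; as [b n] lies in the range of [f],
     their images give back [b n]. *)
  exists (fun n => f @^-1` b n); split=> [n|].
    have [fb sb] := ab n; split.
      by apply: finite_preimage => // x y _ _; exact: f_inj.
    by move=> x /sb [y ay /f_inj <-].
  apply/BE; rewrite image_bigcup.
  have -> // : \bigcup_n (f @` (f @^-1` b n)) = \bigcup_n b n.
  apply: eq_bigcupr => n _; apply/seteqP; split=> [_ [x bx <-] //|y bny].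
  by have [x _ xy] := (ab n).2 _ bny; exists x => //=; rewrite xy.
- have [b [ab Bb]] := SAB (fun n => f @^-1` a n) (fun n => A_preimage (Aa n)).
  exists (fun n => f @` b n); split=> [n|].
    have [fb sb] := ab n; split; first exact: finite_image.
    by move=> _ [x /sb ax <-].
  by rewrite -image_bigcup; apply/BE.
Qed.

Lemma S_star_transfer s : S_star s A B <-> S_star s A' B'.
Proof. by case: s; [exact: S_1_transfer|exact: S_fin_transfer]. Qed.

End selection_transfer.

(* [P] stands for the compact or the finite subsets of [X], and [f] for
   complementation. *)
Section covers_of_families.
Context {X T : topologicalType} (P : set (set X)) (f : T -> set X) (e : T).
Hypothesis P1 : forall x, P [set x].
Hypothesis f_inj : injective f.
Hypothesis f_open : forall t, open (f t).
Hypothesis fe : f e = [set: X].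
Hypothesis nbhs_f : forall t W, nbhs t W <->
  exists D, [/\ P D, D `<=` f t & [set s | D `<=` f s] `<=` W].

(** Omitting the empty closed set on one side is non-triviality of the cover on the other. *)
Let image_notT W : (~ W e) <-> (~ (f @` W) [set: X]).
Proof.
by rewrite -fe; split=> nW; [move=> [x Wx /f_inj xe]; apply: nW; rewrite -xe|
  move=> We; apply: nW; exists e].
Qed.

Let image_cover W : ~ W e ->
    (forall x, exists2 V, (f @` W) V & [set x] `<=` V) ->
  nontrivial_open_cover (f @` W).
Proof.
move=> /image_notT nWe Wx; split; last by move=> _ [t _ <-].
split=> //; apply/seteqP; split=> // x _.
by have [V WV xV] := Wx x; exists V => //; exact: xV.
Qed.

(** The sets of all [s] with [D] inside [f s], for [D] in [P], are open, contain [e], and shrink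
    into any neighbourhood; density need only be tested on them. *)
Lemma dense_familyP W : dense W <->
  forall D, P D -> exists2 V, (f @` W) V & D `<=` V.
Proof.
split=> [dW D PD|WP O [t Ot] oO].
- have [| |t [Dt Wt]] := dW [set s | D `<=` f s].
  + by exists e => x _; rewrite fe.
  + by rewrite openE => t Dt; apply/nbhs_f; exists D; split.
  + by exists (f t) => //; exists t.
- have /nbhs_f[D [PD Dt DO]] : nbhs t O by apply: open_nbhs_nbhs.
  have [_ [s Ws <-] Ds] := WP _ PD.
  by exists s; split=> //; exact: DO.
Qed.

Lemma D_Omega_cover W : D_Omega e W <-> nontrivial_open_cover (f @` W) /\
  forall D, P D -> exists2 V, (f @` W) V & D `<=` V.
Proof.
split=> [[/dense_familyP dW nWe]|[[[_ nT] _] dW]]; split=> //.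
- by apply: image_cover => // x; exact: dW.
- exact/dense_familyP.
- exact/image_notT.
Qed.

Let exceptionsE D W :
  f @` [set s | W s /\ ~ D `<=` f s] = [set V | (f @` W) V /\ ~ D `<=` V].
Proof.
apply/seteqP; split=> [_ [s [Ws nD] <-]|V [[s Ws <-] nD]]; last by exists s.
by split=> //; exists s.
Qed.

Let finite_imageE A : finite_set (f @` A) <-> finite_set A.
Proof.
split=> [fA|]; last exact: finite_image.
apply: sub_finite_set (finite_preimage _ fA); first exact: preimage_image.
by move=> x y _ _; exact: f_inj.
Qed.

(** The points of [W] outside the basic set given by [D] correspond to the members of the image that
    fail to contain [D]; injectivity of [f] preserves finiteness both ways. *)
Lemma D_Gamma_cover W : D_Gamma e W <->
  [/\ nontrivial_open_cover (f @` W), infinite_set (f @` W) &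
  forall D, P D -> finite_set [set V | (f @` W) V /\ ~ D `<=` V]].
Proof.
have conv : (forall (t : T) O, nbhs t O -> finite_set [set s | W s /\ ~ O s]) <->
    (forall D, P D -> finite_set [set V | (f @` W) V /\ ~ D `<=` V]).
  split=> [cW D PD|cW s O /nbhs_f[D [PD _ DO]]].
    rewrite -exceptionsE; apply/finite_imageE.
    (* Convergence at [e] alone suffices: [f e] is all of [X], so every [D] in [P] gives a
       neighbourhood of [e]. *)
    apply: (cW e [set s | D `<=` f s]).
    by apply/nbhs_f; exists D; split=> //; rewrite fe.
  have := cW _ PD; rewrite -exceptionsE => /finite_imageE; apply: sub_finite_set.
  by move=> t [Wt nO]; split=> // /DO.
split=> [[iW nWe /conv cW]|[[[_ nT] _] iW /conv cW]].
- have iW' : infinite_set (f @` W) by move/finite_imageE.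
  split=> //; apply: image_cover => // x.
  (* Were [x] in no member, every member would be an exception for the singleton of [x], making the
     infinite image finite. *)
  apply: contrapT => nx; apply: iW'; apply: sub_finite_set (cW _ (P1 x)).
  by move=> V WV; split=> // xV; apply: nx; exists V.
- by split=> //; [move/finite_imageE|exact/image_notT].
Qed.

End covers_of_families.

Section complement.
Context {X : topologicalType}.

Definition compl_closed (F : hyperspace X) : set X := ~` val F.

Lemma compl_closed_inj : injective compl_closed.
Proof. by move=> F G /setC_inj /val_inj. Qed.

Lemma open_compl_closed F : open (compl_closed F).
Proof. by apply: closed_openC; exact: set_valP. Qed.

Lemma compl_empty_closed : compl_closed empty_closed = [set: X].
Proof. exact: setC0. Qed.

Lemma open_sub_range (U : set (set X)) : U `<=` open -> U `<=` range compl_closed.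
Proof.
move=> oU V /oU /open_closedC cV.
by exists (SigSub (mem_set cV)) => //; exact: setCK.
Qed.

Lemma plus_setC_compl D : plus_set (~` D) = [set F | D `<=` compl_closed F].
Proof.
by apply/seteqP; split=> F /= FD x Dx Fx; [exact: FD Fx Dx|exact: FD Fx Dx].
Qed.

End complement.

Lemma miss_baseE (X : topologicalType) (Q : set (set X)) :
  [set plus_set (~` D) | D in Q] =
  [set [set F | D `<=` compl_closed F] | D in Q].
Proof. by apply: eq_imagel => D _; rewrite plus_setC_compl. Qed.

(* [D = set0] accounts for the basic open set [2^X]. *)
Lemma nbhs_miss_basis (X T : topologicalType) (P : set (set X))
    (f : T -> set X) (t : T) (W : set T) : P set0 ->
  basis ([set [set s | D `<=` f s] | D in [set D | D !=set0 /\ P D]]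
    `|` [set [set: T]]) ->
  nbhs t W <-> exists D, [/\ P D, D `<=` f t & [set s | D `<=` f s] `<=` W].
Proof.
move=> P0 [Bo Bnbhs]; split=> [/Bnbhs[V [BV Vt] VW]|[D [PD Dt DW]]].
  case: BV => [[D [_ PD] DV]|VT]; first by exists D; rewrite -DV in Vt VW.
  by exists set0; split=> // s _; apply: VW; rewrite VT.
apply: filterS DW _; have [D0|D0] := pselect (D !=set0).
  by apply: open_nbhs_nbhs; split=> //; apply: Bo; left; exists D.
suff -> : [set s | D `<=` f s] = [set: T] by exact: filterT.
by apply/seteqP; split=> // s _ x Dx; case: D0; exists x.
Qed.

Lemma nbhs_fell_plus (X : topologicalType) (F : fell_plus X) W : nbhs F W <->
  exists D, [/\ compact D, D `<=` compl_closed F &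
    [set G | D `<=` compl_closed G] `<=` W].
Proof.
apply: nbhs_miss_basis; first exact: compact0.
by rewrite -miss_baseE; exact: fell_base_basis.
Qed.

Lemma nbhs_z_plus (X : topologicalType) (F : z_plus X) W : nbhs F W <->
  exists D, [/\ finite_set D, D `<=` compl_closed F &
    [set G | D `<=` compl_closed G] `<=` W].
Proof.
apply: nbhs_miss_basis; first exact: finite_set0.
by rewrite -miss_baseE; exact: z_base_basis.
Qed.

(** With [P] the compact sets, the abstract characterisations unfold to exactly [gamma_k_cover] and
    [k_cover]; the finite sets serve likewise for the other topology. *)
Lemma D_fellE (X : topologicalType) p W :
  D_fell X p W <-> phi_covers X p (compl_closed @` W).
Proof.
case: p.
- exact: (@D_Gamma_cover X (fell_plus X) compact compl_closed empty_closed (@compact_set1 X)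
    compl_closed_inj open_compl_closed compl_empty_closed (@nbhs_fell_plus X) W).
- exact: (@D_Omega_cover X (fell_plus X) compact compl_closed empty_closed (@compact_set1 X)
    compl_closed_inj open_compl_closed compl_empty_closed (@nbhs_fell_plus X) W).
Qed.

Lemma D_zE (X : topologicalType) q W :
  D_z X q W <-> psi_covers X q (compl_closed @` W).
Proof.
case: q.
- exact: (@D_Gamma_cover X (z_plus X) finite_set compl_closed empty_closed (@finite_set1 X)
    compl_closed_inj open_compl_closed compl_empty_closed (@nbhs_z_plus X) W).
- exact: (@D_Omega_cover X (z_plus X) finite_set compl_closed empty_closed (@finite_set1 X)
    compl_closed_inj open_compl_closed compl_empty_closed (@nbhs_z_plus X) W).
Qed.

Lemma phi_covers_open (X : topologicalType) p U : phi_covers X p U -> U `<=` open.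
Proof. by case: p => [[[]]|[[]]]. Qed.

Theorem theorem5p1 (Phi : phi) (Psi : psi) (s : star) (X : topologicalType)
    (hausdorffX : hausdorff_space X) (noncompactX : ~ compact [set: X]%classic) :
  S_star s (phi_covers X Phi) (psi_covers X Psi) <->
  S_star s (D_fell X Phi) (D_z X Psi).
Proof.
(* What remains is that covers in [Phi] consist of complements of closed sets, and that both kinds
   of families correspond under complementation. *)
apply: (S_star_transfer compl_closed_inj) => [U /phi_covers_open|W|W].
- exact: open_sub_range.
- exact: D_fellE.
- exact: D_zE.
Qed.
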